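(* For fixed $\hat{x}\in[0,1]^{|J|}$, define for all $i\in I$ $$a_i(\hat x):=U_i^L+\sum_{j\in J}w_{ij}\hat x_j,\quad w_i^{\min}(\hat x):=\min_{y\in\overline{\mathcal{Y}}}\Bigl\{U_i^F+\sum_{j\in J}w_{ij}(1-\hat x_j)y_j\Bigr\},\quad w_i^{\max}(\hat x):=\max_{y\in\overline{\mathcal{Y}}}\Bigl\{U_i^F+\sum_{j\in J}w_{ij}(1-\hat x_j)y_j\Bigr\},$$ where $\overline{\mathcal{Y}}:=\{y\in\{0,1\}^{|J|}:\sum_{j\in J}y_j=r\}$. Define $$\alpha(\hat x):=\sum_{i\in I}h_i\left[\frac{a_i(\hat x)\bigl(a_i(\hat x)+w_i^{\max}(\hat x)+w_i^{\min}(\hat x)-U_i^F\bigr)}{\bigl(a_i(\hat x)+w_i^{\max}(\hat x)\bigr)\bigl(a_i(\hat x)+w_i^{\min}(\hat x)\bigr)}\right]$$ and the vector $\beta(\hat x)=[\beta_1(\hat x),\dots,\beta_{|J|}(\hat x)]^{\top}$ with $$\beta_j(\hat x):=\sum_{i\in I}h_i\left[\frac{a_i(\hat x)w_{ij}(1-\hat x_j)}{\bigl(a_i(\hat x)+w_i^{\max}(\hat x)\bigr)\bigl(a_i(\hat x)+w_i^{\min}(\hat x)\bigr)}\right],\quad j\in J.$$ Then $$L(\hat x,y)\le\alpha(\hat x)-\beta(\hat x)^{\top}y\qquad\forall y\in\overline{\mathcal{Y}}.$$ In addition, the problem $\min_{y\in\overline{\mathcal{Y}}}\{\alpha(\hat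 x)-\beta(\hat x)^{\top}y\}$ admits as an optimal solution the vector $\hat y\in\{0,1\}^{|J|}$ whose support is $\{[1],\dots,[r]\}$, where $\{[j]:j\in J\}$ is a sorting of $J$ such that $\beta_{[1]}(\hat x)\ge\beta_{[2]}(\hat x)\ge\cdots\ge\beta_{[|J|]}(\hat x)$.
   Context: $I$ is a finite nonempty set of customer nodes; $J$ (candidate sites, identified with $\{1,\dots,|J|\}$), $J^L$ and $J^F$ (pre-existing facilities of leader and follower) are finite pairwise disjoint sets. Demand weights $h_i\ge 0$ satisfy $\sum_{i\in I}h_i=1$. With real attractiveness levels $\alpha_j$, distances $d_{ij}\ge 0$ and a constant $\beta>0$ (unrelated to the function $\alpha(\hat x)$ and vector $\beta(\hat x)$ in the claim), set $w_{ij}:=\exp\{\alpha_j-\beta d_{ij}\}>0$ for $i\in I$, $j\in J\cup J^L\cup J^F$, and $U_i^L:=\sum_{j\in J^L}w_{ij}\ge 0$, $U_i^F:=\sum_{j\in J^F}w_{ij}\ge 0$. The follower's budget $r$ is a nonnegative integer with $r\le|J|$. Notation: $a\vee b:=\max\{a,b\}$ and $$L(x,y):=\sum_{i\in I}h_i\,\frac{U_i^L+\sum_{j\in J}w_{ij}x_j}{U_i^L+U_i^F+\sum_{j\in J}w_{ij}(x_j\vee y_j)}.$$ Convention: $0/0:=0$. *)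

(* Defs.v *)
From mathcomp Require Import all_boot all_order all_algebra all_fingroup.
From mathcomp Require Import reals sequences exp.
Set Implicit Arguments. Unset Strict Implicit. Unset Printing Implicit Defensive.
Import Order.TTheory GRing.Theory Num.Theory.
Local Open Scope ring_scope.

(* Pairwise disjointness of the candidate sites J = {0, ..., n-1}, the leader's
   facilities JL and the follower's facilities JF is built into the sum type.
   Division is total with x / 0 = 0, in particular 0 / 0 = 0. *)
Definition facility (n : nat) (JL JF : finType) : Type := ('I_n + JL + JF)%type.

Definition weight (R : realType) (I JL JF : finType) (n : nat)
    (attr : facility n JL JF -> R) (b : R) (dist : I -> facility n JL JF -> R)
    (i : I) (j : facility n JL JF) : R :=
  expR (attr j - b * dist i j).

Definition wJ (R : realType) (I JL JF : finType) (n : nat)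
    (w : I -> facility n JL JF -> R) (i : I) (j : 'I_n) : R := w i (inl (inl j)).

Definition UL (R : realType) (I JL JF : finType) (n : nat)
    (w : I -> facility n JL JF -> R) (i : I) : R :=
  \sum_(j : JL) w i (inl (inr j)).

Definition UF (R : realType) (I JL JF : finType) (n : nat)
    (w : I -> facility n JL JF -> R) (i : I) : R :=
  \sum_(j : JF) w i (inr j).

Definition L (R : realType) (I JL JF : finType) (n : nat)
    (h : I -> R) (w : I -> facility n JL JF -> R) (x y : 'cV[R]_n) : R :=
  \sum_(i : I) h i *
    ((UL w i + \sum_(j < n) wJ w i j * x j 0) /
     (UL w i + UF w i + \sum_(j < n) wJ w i j * Num.max (x j 0) (y j 0))).

Definition Ybar (n r : nat) : {set {ffun 'I_n -> bool}} :=
  [set y : {ffun 'I_n -> bool} | (\sum_(j < n) y j)%N == r].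

Definition vec (R : realType) (n : nat) (y : {ffun 'I_n -> bool}) : 'cV[R]_n :=
  \col_(j < n) (y j)%:R.

Definition first_sites (n r : nat) : {ffun 'I_n -> bool} :=
  [ffun j : 'I_n => (j < r)%N].

Lemma first_sites_Ybar (n r : nat) : (r <= n)%N -> first_sites n r \in Ybar n r.
Proof.
move=> rn; rewrite inE; apply/eqP.
under eq_bigr do rewrite ffunE.
rewrite -(big_mkord xpredT (fun j => nat_of_bool (j < r)%N)).
rewrite (big_cat_nat (leq0n r) rn) /=.
rewrite (@eq_big_nat _ _ _ 0 r _ (fun=> 1%N)); last by move=> j /= ->.
rewrite (@eq_big_nat _ _ _ r n _ (fun=> 0%N)).
  by rewrite !sum_nat_const_nat muln1 muln0 addn0 subn0.
by move=> j /andP[rj _]; rewrite ltnNge rj.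
Qed.

(* [first_sites n r] only witnesses that [Ybar n r] is nonempty when r <= n;
   see [minYP] and [maxYP]. *)
Definition minY (R : realType) (n r : nat) (f : {ffun 'I_n -> bool} -> R) : R :=
  f [arg min_(y < first_sites n r in Ybar n r) f y]%O.

Definition maxY (R : realType) (n r : nat) (f : {ffun 'I_n -> bool} -> R) : R :=
  f [arg max_(y > first_sites n r in Ybar n r) f y]%O.

Lemma minYP (R : realType) (n r : nat) (f : {ffun 'I_n -> bool} -> R) :
  (r <= n)%N ->
  (exists2 y, y \in Ybar n r & minY r f = f y) /\
  (forall y, y \in Ybar n r -> minY r f <= f y).
Proof.
move=> rn; rewrite /minY; case: arg_minP; first exact: first_sites_Ybar.
by move=> y yY ymin; split=> //; exists y.
Qed.

Lemma maxYP (R : realType) (n r : nat) (f : {ffun 'I_n -> bool} -> R) :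
  (r <= n)%N ->
  (exists2 y, y \in Ybar n r & maxY r f = f y) /\
  (forall y, y \in Ybar n r -> f y <= maxY r f).
Proof.
move=> rn; rewrite /maxY; case: arg_maxP; first exact: first_sites_Ybar.
by move=> y yY ymax; split=> //; exists y.
Qed.

Definition a (R : realType) (I JL JF : finType) (n : nat)
    (w : I -> facility n JL JF -> R) (x : 'cV[R]_n) (i : I) : R :=
  UL w i + \sum_(j < n) wJ w i j * x j 0.

Definition wmin (R : realType) (I JL JF : finType) (n r : nat)
    (w : I -> facility n JL JF -> R) (x : 'cV[R]_n) (i : I) : R :=
  minY r (fun y => UF w i + \sum_(j < n) wJ w i j * (1 - x j 0) * vec R y j 0).

Definition wmax (R : realType) (I JL JF : finType) (n r : nat)
    (w : I -> facility n JL JF -> R) (x : 'cV[R]_n) (i : I) : R :=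
  maxY r (fun y => UF w i + \sum_(j < n) wJ w i j * (1 - x j 0) * vec R y j 0).

Definition alpha (R : realType) (I JL JF : finType) (n r : nat)
    (h : I -> R) (w : I -> facility n JL JF -> R) (x : 'cV[R]_n) : R :=
  \sum_(i : I) h i *
    ((a w x i * (a w x i + wmax r w x i + wmin r w x i - UF w i)) /
     ((a w x i + wmax r w x i) * (a w x i + wmin r w x i))).

Definition beta (R : realType) (I JL JF : finType) (n r : nat)
    (h : I -> R) (w : I -> facility n JL JF -> R) (x : 'cV[R]_n) : 'cV[R]_n :=
  \col_(j < n) \sum_(i : I) h i *
    ((a w x i * wJ w i j * (1 - x j 0)) /
     ((a w x i + wmax r w x i) * (a w x i + wmin r w x i))).

(* [s k] is the site in position k + 1, i.e. [k + 1] in bracket notation. *)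
Definition is_sorting (R : realType) (n : nat) (c : 'cV[R]_n) (s : {perm 'I_n}) :
    Prop :=
  forall k l : 'I_n, (k <= l)%N -> c (s l) 0 <= c (s k) 0.

Lemma exists_sorting (R : realType) (n : nat) (c : 'cV[R]_n) :
  exists s : {perm 'I_n}, is_sorting c s.
Proof.
pose ge_c := [rel i j : 'I_n | c j 0 <= c i 0].
have [p Ep] := tuple_permP (t := ord_tuple n) (permEl (perm_sort ge_c _)).
exists p => k l kl.
have ge_tr : transitive ge_c by move=> j i m /= ij jm; exact: le_trans jm ij.
have ge_tot : total ge_c by move=> i j; exact: le_total.
have sz : size (sort ge_c (ord_tuple n)) = n by rewrite size_sort size_tuple.
have nthE (i : 'I_n) : nth k (sort ge_c (ord_tuple n)) i = p i.
  by rewrite Ep -tnth_nth tnth_mktuple tnth_ord_tuple.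
rewrite -(nthE l) -(nthE k).
apply: (sorted_leq_nth ge_tr _ k (sort_sorted ge_tot _)) => //=.
  by move=> i; exact: lexx.
all: by rewrite inE sz.
Qed.

Definition is_minimizer (R : realType) (n r : nat)
    (f : {ffun 'I_n -> bool} -> R) (y : {ffun 'I_n -> bool}) : Prop :=
  y \in Ybar n r /\ forall z, z \in Ybar n r -> f y <= f z.

(* Main.v *)
(* With q <= t <= p, the inequality a / t <= a (p + q - t) / (p q) amounts to
   (p - t) (t - q) >= 0.  For x in [0, 1] and binary y, max (x, y) =
   x + (1 - x) y, so the denominators of L are t = a + W(y) with W affine, and
   this bounds each ratio of L by an affine function of y.  Minimizing that
   bound over the y with r ones is maximizing a linear form, and a threshold
   separates the r largest coefficients from the others. *)

Require Import Defs.
From mathcomp Require Import all_boot all_order all_algebra all_fingroup.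
From mathcomp Require Import reals sequences exp.
From mathcomp Require Import ring lra zify.

Set Implicit Arguments. Unset Strict Implicit. Unset Printing Implicit Defensive.
Import Order.TTheory GRing.Theory Num.Theory.
Local Open Scope ring_scope.

(** For [a > 0] the map [t |-> a / (a + t)] is convex on [[m, M]]; the right side is its chord,
    affine in [t] and exact at [t = m] and [t = M]. *)
Lemma ler_div_chord (R : realFieldType) (a m M t : R) :
  0 <= a -> 0 <= m -> m <= t <= M ->
  a / (a + t) <= a * (a + M + m - t) / ((a + M) * (a + m)).
Proof.
(* For [a = 0] denominators may vanish, but the zero numerators make both sides 0. *)
move=> a_ge0 m_ge0 /andP[mt tM]; have [->|a_neq0] := eqVneq a 0.
  by rewrite !mul0r.
have a_gt0 : 0 < a by rewrite lt_def a_neq0.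
have [am0 [at0 aM0]] : 0 < a + m /\ 0 < a + t /\ 0 < a + M by lra.
rewrite ler_pdivrMr // mulrAC ler_pdivlMr ?mulr_gt0 // -mulrA.
rewrite ler_wpM2l // -subr_ge0.
have -> : (a + M + m - t) * (a + t) - (a + M) * (a + m) = (M - t) * (t - m).
  by ring.
by rewrite mulr_ge0 ?subr_ge0.
Qed.

Lemma max_bool (R : realDomainType) (x : R) (c : bool) :
  0 <= x <= 1 -> Num.max x c%:R = x + (1 - x) * c%:R.
Proof.
case/andP=> x0 x1; case: c.
  by rewrite mulr1 addrC subrK max_r.
by rewrite mulr0 addr0 max_l.
Qed.

Lemma Ybar_sumr (R : realType) (n r : nat) (y : {ffun 'I_n -> bool}) :
  y \in Ybar n r -> \sum_(j < n) (y j)%:R = r%:R :> R.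
Proof. by rewrite inE => /eqP <-; rewrite natr_sum. Qed.

Section Sorting.
Variables (R : realType) (n r : nat) (c : 'cV[R]_n) (s : {perm 'I_n}).
Variable y : {ffun 'I_n -> bool}.
Hypothesis supp_y : [set j | y j] = [set s k | k in [set k : 'I_n | (k < r)%N]].

Lemma top_sitesE (k : 'I_n) : y (s k) = (k < r)%N.
Proof.
have : (s k \in [set j | y j]) = (k < r)%N.
  by rewrite supp_y mem_imset ?inE //; exact: perm_inj.
by rewrite inE.
Qed.

(** Reindexing along [s] turns [y] into [first_sites n r], whose ones are already counted. *)
Lemma top_sites_Ybar : (r <= n)%N -> y \in Ybar n r.
Proof.
move=> /first_sites_Ybar; rewrite !inE => /eqP <-; apply/eqP.
rewrite (reindex_inj (@perm_inj _ s)) /=; apply: eq_bigr => k _.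
by rewrite top_sitesE ffunE.
Qed.

(** For [r > 0] the threshold is the [r]-th largest coefficient, found at the 0-based position
    [r.-1]. *)
Lemma top_sites_threshold : is_sorting c s -> (r <= n)%N ->
  exists t, forall j, if y j then t <= c j 0 else c j 0 <= t.
Proof.
(* Without sites the condition is vacuous; otherwise [r.-1] is a genuine position. *)
move=> sorted_s rn; case: (posnP n) => [n0|n_gt0].
  by exists 0 => j; have := ltn_ord j; rewrite {2}n0.
have r1n : (r.-1 < n)%N by apply: leq_ltn_trans (_ : (n.-1 < n)%N); lia.
(* For r = 0 the truncated r.-1 is 0, and the largest coefficient is a valid
   threshold. *)
exists (c (s (Ordinal r1n)) 0) => j; rewrite -(permKV s j) top_sitesE.
by case: ltnP => kr; apply: sorted_s => /=; lia.
Qed.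

(** Both vectors have [r] ones, so lowering every coefficient by [t] lowers both sums by [t * r].
    The shifted coefficients are nonnegative on the support of [y] and nonpositive off it, so [y]
    wins term by term. *)
Lemma top_sites_max (z : {ffun 'I_n -> bool}) :
  is_sorting c s -> (r <= n)%N -> z \in Ybar n r ->
  \sum_(j < n) c j 0 * (z j)%:R <= \sum_(j < n) c j 0 * (y j)%:R.
Proof.
move=> sorted_s rn zY; have [t tP] := top_sites_threshold sorted_s rn.
have E u : u \in Ybar n r -> \sum_(j < n) c j 0 * (u j)%:R =
    \sum_(j < n) (c j 0 - t) * (u j)%:R + t * r%:R.
  move=> /(@Ybar_sumr R) <-; rewrite mulr_sumr -big_split /=.
  by apply: eq_bigr => j _; rewrite -mulrDl subrK.
rewrite !E ?top_sites_Ybar // lerD2r; apply: ler_sum => j _.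
by have := tP j; case: (y j); case: (z j) => /=; lra.
Qed.

End Sorting.

Section Bound.
Variables (R : realType) (I JL JF : finType) (n r : nat).
Variables (h : I -> R) (w : I -> facility n JL JF -> R) (x : 'cV[R]_n).
Hypotheses (h_ge0 : forall i, 0 <= h i) (w_ge0 : forall i j, 0 <= w i j).
Hypotheses (x01 : forall j, 0 <= x j 0 <= 1) (r_le_n : (r <= n)%N).

(** Matches the objective inside [wmin] and [wmax], which are thus the extremes of [W i] by
    conversion. *)
Let W (i : I) (y : {ffun 'I_n -> bool}) : R :=
  UF w i + \sum_(j < n) wJ w i j * (1 - x j 0) * vec R y j 0.

Lemma W_ge0 i y : 0 <= W i y.
Proof.
rewrite addr_ge0 ?sumr_ge0 // => j _; have /andP[_ x1] := x01 j.
by rewrite [vec _ _ _ _]mxE !mulr_ge0 ?subr_ge0 ?ler0n // w_ge0.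
Qed.

Lemma a_ge0 i : 0 <= a w x i.
Proof.
rewrite addr_ge0 ?sumr_ge0 // => j _; have /andP[x0 _] := x01 j.
by rewrite mulr_ge0 ?w_ge0.
Qed.

Lemma wmin_ge0 i : 0 <= wmin r w x i.
Proof.
by have [[y _ Ey] _] := minYP (W i) r_le_n; rewrite /wmin Ey W_ge0.
Qed.

Lemma W_between i y : y \in Ybar n r -> wmin r w x i <= W i y <= wmax r w x i.
Proof.
move=> yY; apply/andP; split.
  by have [_ ->] := minYP (W i) r_le_n.
by have [_ ->] := maxYP (W i) r_le_n.
Qed.

Lemma L_denominatorE i y :
  UL w i + UF w i + \sum_(j < n) wJ w i j * Num.max (x j 0) (vec R y j 0) =
  a w x i + W i y.
Proof.
rewrite /a /W addrACA -big_split /=; congr (_ + _); apply: eq_bigr => j _.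
by rewrite [vec _ _ _ _]mxE max_bool // mulrDr mulrA.
Qed.

(** Puts the bound in the chord form of [ler_div_chord]: [beta] carries only the linear part of
    [W i y], and the [- UF w i] inside [alpha] supplies its constant part. *)
Lemma alpha_betaE y :
  alpha r h w x - ((beta r h w x)^T *m vec R y) 0 0 =
  \sum_(i : I) h i *
    (a w x i * (a w x i + wmax r w x i + wmin r w x i - W i y) /
     ((a w x i + wmax r w x i) * (a w x i + wmin r w x i))).
Proof.
have -> : ((beta r h w x)^T *m vec R y) 0 0 = \sum_(i : I) h i *
    (a w x i * (W i y - UF w i) /
     ((a w x i + wmax r w x i) * (a w x i + wmin r w x i))).
  rewrite mxE; under eq_bigr do rewrite [_^T _ _]mxE mxE mulr_suml.
  rewrite exchange_big; apply: eq_bigr => i _ /=.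
  rewrite /W [UF w i + _]addrC addrK mulr_sumr mulr_suml mulr_sumr.
  by apply: eq_bigr => j _; rewrite mxE; ring.
rewrite -sumrB; apply: eq_bigr => i _; ring.
Qed.

(** The chord inequality is applied customer by customer, with [t = W i y] between [wmin] and
    [wmax], then averaged with the weights [h i]. *)
Lemma L_le_alpha_beta y : y \in Ybar n r ->
  L h w x (vec R y) <= alpha r h w x - ((beta r h w x)^T *m vec R y) 0 0.
Proof.
move=> yY; rewrite alpha_betaE; apply: ler_sum => i _; rewrite ler_wpM2l //.
by rewrite L_denominatorE ler_div_chord ?a_ge0 ?wmin_ge0 ?W_between.
Qed.

End Bound.

Theorem proposition5 (R : realType) (I JL JF : finType) (n r : nat)
    (h : I -> R) (attr : facility n JL JF -> R)
    (dist : I -> facility n JL JF -> R) (b : R)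
    (I_nonempty : (0 < #|I|)%N)
    (h_ge0 : forall i, 0 <= h i) (h_sum1 : \sum_(i : I) h i = 1)
    (dist_ge0 : forall i j, 0 <= dist i j) (b_gt0 : 0 < b)
    (r_le_n : (r <= n)%N)
    (x : 'cV[R]_n) (x01 : forall j : 'I_n, 0 <= x j 0 <= 1) :
  let w := weight attr b dist in
  (forall y, y \in Ybar n r ->
     L h w x (vec R y) <= alpha r h w x - ((beta r h w x)^T *m vec R y) 0 0) /\
  (forall (s : {perm 'I_n}) (yhat : {ffun 'I_n -> bool}),
     is_sorting (beta r h w x) s ->
     [set j | yhat j] = [set s k | k in [set k : 'I_n | (k < r)%N]] ->
     is_minimizer r
       (fun y => alpha r h w x - ((beta r h w x)^T *m vec R y) 0 0) yhat).
Proof.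
move=> w; split=> [y|s yhat sorted_s supp_y].
  by apply: L_le_alpha_beta => // i j; exact: expR_ge0.
split=> [|z zY]; first exact: top_sites_Ybar supp_y r_le_n.
have E u : ((beta r h w x)^T *m vec R u) 0 0 =
    \sum_(j < n) beta r h w x j 0 * (u j)%:R.
  by rewrite mxE; apply: eq_bigr => j _; rewrite mxE [vec _ _ _ _]mxE.
by rewrite lerD2l lerN2 !E; exact: top_sites_max supp_y _ sorted_s r_le_n zY.
Qed.
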